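(* Let $G$ be a signed graph on $n$ nodes with Gremban expansion $\mathcal{G}$ and Gremban Laplacian $\mathcal{L}$, and let $\psi=(\psi^+,\psi^-)^\top\in\mathbb{R}^{2n}$ be an eigenvector of $\mathcal{L}$ (possibly with zero entries), where $\psi^\chi(v)$ denotes the entry at $v^\chi$. Define the bipartition $V(\mathcal{G})=\mathcal{U}_1\cup\mathcal{U}_2$ as follows: if $\psi$ is symmetric, $\mathcal{U}_1=\{v^\chi:\psi^\chi(v)\ge0\}$ and $\mathcal{U}_2=\{v^\chi:\psi^\chi(v)<0\}$; if $\psi$ is antisymmetric, $\mathcal{U}_1=\{v^\chi:\psi^\chi(v)>0\}\cup\{v^+:\psi^+(v)=0\}$ and $\mathcal{U}_2=\{v^\chi:\psi^\chi(v)<0\}\cup\{v^-:\psi^-(v)=0\}$. Then: if $\psi$ is symmetric, the cut-set $C(\mathcal{U}_1,\mathcal{U}_2)$ is Gremban-symmetric and $\pi(C(\mathcal{U}_1,\mathcal{U}_2))$ is a cut-set of $G$; if $\psi$ is antisymmetric, $C(\mathcal{U}_1,\mathcal{U}_2)$ is Gremban-symmetric and $\pi(C(\mathcal{U}_1,\mathcal{U}_2))$ is a frustration set of $G$.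
   Context: A signed graph $G=(V,E,\sigma)$ has node set $V=\{1,\dots,n\}$, undirected edges without loops or multi-edges, and $\sigma:E\to\{\pm1\}$. Its Gremban expansion $\mathcal{G}$ has nodes $v^+,v^-$ and edges $(u^\chi,v^{\chi\sigma(u,v)})$ for $(u,v)\in E,\chi\in\{\pm\}$. The Gremban involution $\eta(v^\chi)=v^{-\chi}$ acts on edges by $\eta((a,b))=(\eta(a),\eta(b))$; an edge set is Gremban-symmetric if fixed by $\eta$. The projection is $\pi(v^\chi)=v$, $\pi((u^\chi,v^\psi))=(u,v)$. With $A^\pm$ the $0/1$ adjacency matrices of the positive/negative edges and $K$ the diagonal degree matrix, the Gremban Laplacian is $\mathcal{L}=\begin{pmatrix}K-A^+&-A^-\\-A^-&K-A^+\end{pmatrix}$ (first block indexed by $v^+$, second by $v^-$). A vector is symmetric if of the form $(\mathbf{x},\mathbf{x})^\top$ and antisymmetric if of the form $(\mathbf{x},-\mathbf{x})^\top$. For a node partition $S\cup T$, $C(S,T)$ is the set of edges with one end in each; a cut-set of $G$ is any $C(S,T)$ with $V=S\cup T$. A frustration set of $G$ is any $F(\theta)=\{uv\in E:\theta(u)\theta(v)\sigma(uv)=-1\}$ with $\theta:V\to\{\pm1\}$. *)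

(* Defs.v *)
From mathcomp Require Import all_boot all_order all_algebra.

Set Implicit Arguments.
Unset Strict Implicit.
Unset Printing Implicit Defensive.

Import Order.TTheory GRing.Theory Num.Theory.
Local Open Scope ring_scope.

(* A sign is a boolean [b] standing for (-1)^b, so [false] is +, [true] is -,
   and the product of two signs is [(+)] (addb).  Undirected edges are
   two-element sets of nodes. *)

(* [sgn] is total for convenience; its values outside [edges] are never used. *)
Record signedGraph (n : nat) := SignedGraph {
  edges : {set {set 'I_n}};
  edges_card2 : forall e, e \in edges -> #|e| = 2%N;
  sgn : {set 'I_n} -> bool
}.

Section Cuts.
Variables (T : finType) (E : {set {set T}}).

(* One of the two parts may be empty, so [finset.partition] is not used. *)
Definition bipartition (S U : {set T}) : Prop :=
  S :|: U = [set: T] /\ S :&: U = set0.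

Definition cut (S U : {set T}) : {set {set T}} :=
  [set e in E | [exists u in S, [exists v in U, e == [set u; v]]]].

Definition is_cutset (C : {set {set T}}) : Prop :=
  exists S U : {set T}, bipartition S U /\ C = cut S U.

End Cuts.

Section Frustration.
Variables (n : nat) (G : signedGraph n).

Definition frustration (theta : 'I_n -> bool) : {set {set 'I_n}} :=
  [set e in edges G | [exists u, [exists v, (e == [set u; v]) &&
     ((-1) ^+ theta u * (-1) ^+ theta v * (-1) ^+ sgn G e == -1 :> int)]]].

Definition is_frustration_set (F : {set {set 'I_n}}) : Prop :=
  exists theta : 'I_n -> bool, F = frustration theta.

End Frustration.

(* The node v^chi is the pair (v, chi). *)
Notation gnode n := ('I_n * bool)%type.

Section Expansion.
Variable n : nat.

Definition gremban_edges (G : signedGraph n) : {set {set gnode n}} :=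
  [set e | [exists u, [exists v, [exists chi,
     ([set u; v] \in edges G) &&
     (e == [set (u, chi); (v, chi (+) sgn G [set u; v])])]]]].

Definition eta (a : gnode n) : gnode n := (a.1, ~~ a.2).

(* [eta] maps the set of edges to itself; individual edges may move. *)
Definition gremban_symmetric (C : {set {set gnode n}}) : Prop :=
  [set eta @: (e : {set gnode n}) | e in C] = C.

Definition proj (a : gnode n) : 'I_n := a.1.

Definition proj_edges (C : {set {set gnode n}}) : {set {set 'I_n}} :=
  [set proj @: (e : {set gnode n}) | e in C].

End Expansion.

Section Laplacian.
Variables (R : realFieldType) (n : nat).

(* The 0/1 adjacency matrix of the edges of sign [b]. *)
Definition adjmx (G : signedGraph n) (b : bool) : 'M[R]_n :=
  \matrix_(u, v) (([set u; v] \in edges G) && (sgn G [set u; v] == b))%:R.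

(* Degrees count edges of both signs. *)
Definition degmx (G : signedGraph n) : 'M[R]_n :=
  diag_mx (\row_v #|[set e in edges G | v \in e]|%:R).

Definition gremban_laplacian (G : signedGraph n) : 'M[R]_(n + n) :=
  block_mx (degmx G - adjmx G false) (- adjmx G true)
           (- adjmx G true) (degmx G - adjmx G false).

(* Column eigenvectors; MathComp's [eigenspace] is about row vectors. *)
Definition is_eigenvector m (A : 'M[R]_m) (psi : 'cV[R]_m) : Prop :=
  psi != 0 /\ exists a : R, A *m psi = a *: psi.

Definition symmetric_vec (psi : 'cV[R]_(n + n)) : Prop :=
  exists x : 'cV[R]_n, psi = col_mx x x.

Definition antisymmetric_vec (psi : 'cV[R]_(n + n)) : Prop :=
  exists x : 'cV[R]_n, psi = col_mx x (- x).

(* psi^chi(v), for a = (v, chi). *)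
Definition entry (psi : 'cV[R]_(n + n)) (a : gnode n) : R :=
  (if a.2 then dsubmx psi else usubmx psi) a.1 0.

Definition symU1 (psi : 'cV[R]_(n + n)) : {set gnode n} :=
  [set a | 0 <= entry psi a].
Definition symU2 (psi : 'cV[R]_(n + n)) : {set gnode n} :=
  [set a | entry psi a < 0].

Definition antiU1 (psi : 'cV[R]_(n + n)) : {set gnode n} :=
  [set a | 0 < entry psi a] :|: [set a | (a.2 == false) && (entry psi a == 0)].
Definition antiU2 (psi : 'cV[R]_(n + n)) : {set gnode n} :=
  [set a | entry psi a < 0] :|: [set a | (a.2 == true) && (entry psi a == 0)].

Lemma symU_bipartition psi : bipartition (symU1 psi) (symU2 psi).
Proof. by split; apply/setP=> a; rewrite !inE; case: ltP. Qed.

Lemma antiU_bipartition psi : bipartition (antiU1 psi) (antiU2 psi).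
Proof.
by split; apply/setP=> -[v c]; rewrite !inE /=; case: c; case: ltgtP.
Qed.

End Laplacian.

(* Main.v *)
Require Import Defs.
From mathcomp Require Import all_boot all_order all_algebra.

(** In the symmetric case [U1] is the full preimage under the projection of the
    nodes with [x >= 0], so a lift of [uv] is cut iff these nodes separate [u]
    from [v].  In the antisymmetric case [U1] contains exactly one lift of every
    node [v], with sign [theta v], so a lift of [uv] is cut iff
    [theta u * theta v * sigma uv = -1].  The involution [eta] preserves [U1] in
    the first case and exchanges the two parts in the second. *)

Set Implicit Arguments.
Unset Strict Implicit.
Unset Printing Implicit Defensive.

Import Order.TTheory GRing.Theory Num.Theory.
Local Open Scope ring_scope.

Section CutLemmas.
Variables (T : finType) (E : {set {set T}}).

Lemma bipartition_setC (S U : {set T}) : bipartition S U -> U = ~: S.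
Proof.
case=> SUT SU0; apply/setP=> a.
have /setP/(_ a) := SUT; have /setP/(_ a) := SU0; rewrite !inE.
by case: (a \in S); case: (a \in U).
Qed.

Lemma setC_bipartition (S : {set T}) : bipartition S (~: S).
Proof. by rewrite /bipartition setUCr setICr. Qed.

Lemma in_cut_set2 (S : {set T}) a b :
  ([set a; b] \in cut E S (~: S)) =
  ([set a; b] \in E) && ((a \in S) != (b \in S)).
Proof.
rewrite inE; congr (_ && _); apply/exists_inP/idP.
- case=> c Sc /exists_inP[d]; rewrite in_setC => nSd /eqP eq_ab_cd.
  have : c \in [set a; b] by rewrite eq_ab_cd set21.
  have : d \in [set a; b] by rewrite eq_ab_cd set22.
  (* The ends [c] and [d] may match [a] and [b] in either order; the cases with [c = d] contradict
     [c] lying in [S] and [d] outside it. *)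
  rewrite !inE => /orP[]/eqP dE /orP[]/eqP cE; move: Sc nSd;
    by rewrite cE dE; case: (a \in S); case: (b \in S).
- case Sa: (a \in S); case Sb: (b \in S) => // _.
  + by exists a => //; apply/exists_inP; exists b; rewrite ?in_setC ?Sb.
  + by exists b => //; apply/exists_inP; exists a; rewrite ?in_setC ?Sa // setUC.
Qed.

End CutLemmas.

Section GrembanCuts.
Variables (n : nat) (G : signedGraph n).

Definition lift_edge (u v : 'I_n) (chi : bool) : {set gnode n} :=
  [set (u, chi); (v, chi (+) sgn G [set u; v])].

Lemma lift_edge_in u v chi :
  [set u; v] \in edges G -> lift_edge u v chi \in gremban_edges G.
Proof.
move=> uvE; rewrite inE; apply/existsP; exists u; apply/existsP; exists v.
by apply/existsP; exists chi; rewrite uvE eqxx.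
Qed.

Lemma proj_lift_edge u v chi : @proj n @: lift_edge u v chi = [set u; v].
Proof. by rewrite imsetU1 imset_set1. Qed.

Lemma eta_lift_edge u v chi :
  @eta n @: lift_edge u v chi = lift_edge u v (~~ chi).
Proof. by rewrite imsetU1 imset_set1 /eta /= -addNb. Qed.

Lemma gremban_cutP (S : {set gnode n}) e :
  reflect (exists u v chi, [/\ [set u; v] \in edges G, e = lift_edge u v chi
             & ((u, chi) \in S) != ((v, chi (+) sgn G [set u; v]) \in S)])
          (e \in cut (gremban_edges G) S (~: S)).
Proof.
apply: (iffP idP) => [eC|[u [v [chi [uvE -> sep]]]]]; last first.
  by rewrite in_cut_set2 lift_edge_in.
have : e \in gremban_edges G by move: eC; rewrite inE => /andP[].
rewrite inE => /existsP[u /existsP[v /existsP[chi /andP[uvE /eqP def_e]]]].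
by exists u, v, chi; split=> //; move: eC; rewrite def_e in_cut_set2 => /andP[].
Qed.

Lemma proj_gremban_cutP (S : {set gnode n}) e :
  reflect (exists u v chi, [/\ [set u; v] \in edges G, e = [set u; v]
             & ((u, chi) \in S) != ((v, chi (+) sgn G [set u; v]) \in S)])
          (e \in proj_edges (cut (gremban_edges G) S (~: S))).
Proof.
apply: (iffP imsetP) => [[_ /gremban_cutP[u [v [chi [uvE -> sep]]]] ->]|].
  by exists u, v, chi; rewrite proj_lift_edge.
case=> u [v [chi [uvE -> sep]]]; exists (lift_edge u v chi).
  by apply/gremban_cutP; exists u, v, chi.
by rewrite proj_lift_edge.
Qed.

(** The bit [c] treats two situations at once: [false] when [eta] preserves [S], [true] when it
    exchanges [S] with its complement. Either way the memberships of both ends of an edge change by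
    the same bit, so whether they differ is unaffected. *)
Lemma gremban_symmetric_cut (S : {set gnode n}) c :
  (forall a, (eta a \in S) = c (+) (a \in S)) ->
  gremban_symmetric (cut (gremban_edges G) S (~: S)).
Proof.
move=> etaS.
have eta_cut e : e \in cut (gremban_edges G) S (~: S) ->
    @eta n @: e \in cut (gremban_edges G) S (~: S).
  case/gremban_cutP=> u [v [chi [uvE -> sep]]]; rewrite eta_lift_edge.
  apply/gremban_cutP; exists u, v, (~~ chi); split=> //.
  have := etaS (u, chi); have := etaS (v, chi (+) sgn G [set u; v]).
  by rewrite /eta /= -addNb => -> ->; rewrite (inj_eq (@addbI c)).
apply/setP=> e; apply/imsetP/idP => [[f fC ->]|eC]; first exact: eta_cut.
(* Since [eta] is an involution, the image of [e] is also its preimage. *)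
exists (@eta n @: e); first exact: eta_cut.
rewrite -imset_comp (eq_imset (g := id)) ?imset_id // => -[v chi].
by rewrite /eta /= negbK.
Qed.

(** Here [S] is a union of fibres of the projection, so the layers of the two ends, and hence the
    sign of the edge, have no influence on whether a lift is cut. *)
Lemma proj_cut_preim (Q : {set 'I_n}) (S : {set gnode n}) :
  (forall v chi, ((v, chi) \in S) = (v \in Q)) ->
  proj_edges (cut (gremban_edges G) S (~: S)) = cut (edges G) Q (~: Q).
Proof.
move=> SQ; apply/setP=> e; apply/proj_gremban_cutP/idP.
  by case=> u [v [chi [uvE ->]]]; rewrite !SQ in_cut_set2 uvE.
move=> eC; have := eC; rewrite inE => /andP[eE].
case/exists_inP=> u Qu /exists_inP[v]; rewrite in_setC => nQv /eqP def_e.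
(* Both lifts of a cut edge are cut; the one starting at [(u, false)] is taken. *)
by exists u, v, false; rewrite !SQ Qu (negPf nQv) -def_e.
Qed.

Lemma proj_cut_section (theta : 'I_n -> bool) (S : {set gnode n}) :
  (forall v chi, ((v, chi) \in S) = (chi == theta v)) ->
  proj_edges (cut (gremban_edges G) S (~: S)) = frustration G theta.
Proof.
(* Modulo 2 the left side is [x + y + s]: [chi] occurs in both tests and cancels, so the two lifts
   of an edge are cut together. *)
have sepE chi s x y : ((chi == x) != (chi (+) s == y)) =
    ((-1) ^+ x * (-1) ^+ y * (-1) ^+ s == -1 :> int).
  by case: chi; case: s; case: x; case: y.
move=> Stheta; apply/setP=> e; apply/proj_gremban_cutP/idP.
  case=> u [v [chi [uvE ->]]]; rewrite !Stheta sepE => fr.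
  by rewrite inE uvE; apply/existsP; exists u; apply/existsP; exists v; rewrite eqxx.
rewrite inE => /andP[eE /existsP[u /existsP[v /andP[/eqP def_e fr]]]].
by exists u, v, false; rewrite !Stheta sepE -def_e.
Qed.

End GrembanCuts.

Section SignPartitions.
Variables (R : realFieldType) (n : nat) (x : 'cV[R]_n).

Lemma in_symU1 v chi : ((v, chi) \in symU1 (col_mx x x)) = (0 <= x v 0).
Proof. by rewrite inE /entry /= col_mxKd col_mxKu if_same. Qed.

(** The tie rule puts the positive lift of a node with zero entry in the first part, so zeros count
    as positive and the strict test [x v 0 < 0] is the right sign bit. At nonzero entries the two
    lifts carry opposite values, and exactly one is positive. *)
Lemma in_antiU1 v chi :
  ((v, chi) \in antiU1 (col_mx x (- x))) = (chi == (x v 0 < 0)).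
Proof.
rewrite !inE /entry /= col_mxKd col_mxKu.
by case: chi; rewrite /= ?mxE ?oppr_gt0; case: ltgtP.
Qed.

End SignPartitions.

Theorem theorem5 (R : realFieldType) (n : nat) (G : signedGraph n)
    (psi : 'cV[R]_(n + n)) (psi_eig : is_eigenvector (gremban_laplacian R G) psi) :
  (symmetric_vec psi ->
     gremban_symmetric (cut (gremban_edges G) (symU1 psi) (symU2 psi)) /\
     is_cutset (edges G)
       (proj_edges (cut (gremban_edges G) (symU1 psi) (symU2 psi)))) /\
  (antisymmetric_vec psi ->
     gremban_symmetric (cut (gremban_edges G) (antiU1 psi) (antiU2 psi)) /\
     is_frustration_set G
       (proj_edges (cut (gremban_edges G) (antiU1 psi) (antiU2 psi)))).
Proof.
rewrite (bipartition_setC (symU_bipartition psi)).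
rewrite (bipartition_setC (antiU_bipartition psi)).
split=> -[x ->]; split.
- by apply: (@gremban_symmetric_cut _ _ _ false) => -[v chi]; rewrite !in_symU1.
- exists [set v | 0 <= x v 0], (~: [set v | 0 <= x v 0]).
  split; first exact: setC_bipartition.
  by apply: proj_cut_preim => v chi; rewrite in_symU1 inE.
- apply: (@gremban_symmetric_cut _ _ _ true) => -[v chi].
  by rewrite !in_antiU1; case: chi; case: (_ < _).
- exists (fun v => x v 0 < 0).
  by apply: proj_cut_section => v chi; rewrite in_antiU1.
Qed.
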